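(* Let $p$ be an odd prime and $a\in\mathbb Z_p$ with $a\not\equiv0,\pm1\pmod p$. Then $$\sum_{k=0}^{p-1}\binom ak\binom{-1-a}k\binom{2k}k\frac1{4^k(a+k)}\equiv\frac1{2a}S_p(a)+\frac{(a+1)^2}{2a^3}S_p(a+1)$$ $$\equiv\frac{a+1}{2a^2}\sum_{k=0}^{p-2}\binom ak\binom{-1-a}k\binom{2k}k\frac1{4^k(k+1)}-\frac1{2a^2}S_p(a)\pmod{p^3},$$ and $$\sum_{k=0}^{p-1}\binom ak\binom{-1-a}k\binom{2k}k\frac1{4^k(a+k-1)}\equiv\frac{(a-1)^2+1}{2(a-1)^3}S_p(a)+\frac{(a+1)^2}{2a^2(a-1)}S_p(a+1)$$ $$\equiv\frac{a+1}{2a(a-1)}\sum_{k=0}^{p-2}\binom ak\binom{-1-a}k\binom{2k}k\frac1{4^k(k+1)}-\frac{a^2-3a+1}{2a(a-1)^3}S_p(a)\pmod{p^3}.$$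
   Context: For a prime $p$, $\mathbb Z_p$ denotes the set of rational numbers whose denominator is not divisible by $p$, and congruences modulo powers of $p$ are between elements of $\mathbb Z_p$ (the difference divided by that power of $p$ lies in $\mathbb Z_p$). For rational $a$ and integer $k\ge0$, $\binom ak=a(a-1)\cdots(a-k+1)/k!$. Define $S_n(a)=\sum_{k=0}^{n-1}\binom ak\binom{-1-a}k\binom{2k}k\frac1{4^k}$ for $n\ge1$.
   Formalization: If a is a negative integer, a summand with a+k=0 (resp. a+k-1=0) is undefined (e.g. p=5, a=-2, k=2); there binom(-1-a,k)/(a+k) (resp. /(a+k-1)) is given its value after cancelling the linear factor. For all other a the sums are literal. *)

(* Defs.v *)
From mathcomp Require Import all_boot all_order all_algebra.

Set Implicit Arguments.
Unset Strict Implicit.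
Unset Printing Implicit Defensive.

Import Order.TTheory GRing.Theory Num.Theory.
Local Open Scope ring_scope.

Definition Zp_int (p : nat) (x : rat) : bool := ~~ (p %| `|denq x|)%N.

(* x = y (mod p ^ m) as elements of Z_p; both sides are required to lie in
   Z_p. *)
Definition Zp_congr (p m : nat) (x y : rat) : bool :=
  [&& Zp_int p x, Zp_int p y & Zp_int p ((x - y) / p%:R ^+ m)].

Definition gbinom (a : rat) (k : nat) : rat :=
  (\prod_(i < k) (a - i%:R)) / k`!%:R.

(* binom(-1-a, k) / (a + c).  The factor of binom(-1-a, k) of index i is
   - (a + (i + 1)), so when c is one of 1, ..., k this quotient is a polynomial
   in a (see gbinom_quot_nat).  At a = - c, where the literal quotient is 0 / 0
   (and would evaluate to 0 in rat), we take the value of that polynomial. *)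
Definition gbinom_quot (a : rat) (k : nat) (c : rat) : rat :=
  if a + c == 0
  then - (\prod_(i < k | i.+1%:R != c) (-1 - a - i%:R)) / k`!%:R
  else gbinom (-1 - a) k / (a + c).

Definition Ssum (n : nat) (a : rat) : rat :=
  \sum_(k < n) gbinom a k * gbinom (-1 - a) k * 'C(2 * k, k)%:R / 4%:R ^+ k.

Lemma gbinom_quotE (a : rat) (k : nat) (c : rat) :
  a + c != 0 -> gbinom_quot a k c = gbinom (-1 - a) k / (a + c).
Proof. by rewrite /gbinom_quot => /negPf ->. Qed.

Lemma gbinom_quot_nat (a : rat) (k m : nat) : (0 < m <= k)%N ->
  gbinom_quot a k m%:R =
  - (\prod_(i < k | i.+1 != m) (-1 - a - i%:R)) / k`!%:R.
Proof.
case: m => // m lt_mk; rewrite /gbinom_quot.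
case: eqP => [_ | /eqP nz].
  by congr (- _ / _); apply: eq_bigl => i; rewrite eqr_nat.
rewrite /gbinom (bigD1 (Ordinal lt_mk)) //=.
have -> : -1 - a - m%:R = - (a + m.+1%:R).
  by rewrite -natr1 addrA opprD [RHS]addrC opprD addrA.
rewrite !mulNr; congr (- _).
by rewrite -[_ / k`!%:R]mulrA [LHS]mulrC mulKf.
Qed.

(* Main.v *)
(* Both sums, S_p(a), S_p(a + 1) and the sum with 1/(k+1) have summands of the
   form v_k times a polynomial in k and a, where
     v_k = binom(a,k) binom(-1-a,k) binom(2k,k) / (4^k (a+1-k)(a+k)(a+k-1))
   is itself a polynomial in a, up to a constant, for k >= 2.  With this common
   factor, the three differences telescope exactly, in the style of Gosper, and
   the boundary terms are p^3 v_p times p-adic integers.  Finally v_p is a p-adic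
   integer, since p!^3 in its denominator is compensated by the products of
   1/2+i, of a-1+i and of -1-a+i over i < p, each of which is divisible by p. *)
Require Import Defs.
From mathcomp Require Import all_boot all_order all_algebra.
From mathcomp Require Import ring zify.

Import Order.TTheory GRing.Theory Num.Theory.
Local Open Scope ring_scope.

(** * Arithmetic of p-adic integers among the rationals *)

(** The fraction need not be reduced, so closure under sum and product follows from naive fraction
    arithmetic. *)
Lemma Zp_intP (p : nat) (x : rat) : prime p ->
  reflect (exists n : int, exists2 d : nat, ~~ (p %| d)%N & x = n%:~R / d%:R)
          (Zp_int p x).
Proof.
move=> p_pr; apply: (iffP idP) => [px | [n [d pd ->]]].
  exists (numq x), `|denq x|%N => //.
  by rewrite pmulrn absz_denq divq_num_den.
have d0 : d%:Z != 0 by apply: contraNneq pd => -[->]; rewrite dvdn0.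
apply: contra pd => /dvdn_trans; apply.
have -> : d = `|d%:Z|%N by [].
rewrite -[_%:R]/(d%:Z%:~R : rat).
case: divqP d0 => [d0 | k y _ _]; first by case/eqP.
by rewrite abszM dvdn_mull.
Qed.

Section ZpInt.

Variables (p : nat) (p_pr : prime p).

Lemma Zp_int_int (n : int) : Zp_int p n%:~R.
Proof.
apply/Zp_intP => //; exists n, 1%N; last by rewrite divr1.
by rewrite dvdn1 neq_ltn prime_gt1 ?orbT.
Qed.

Lemma Zp_int_nat (n : nat) : Zp_int p n%:R.
Proof. exact: (Zp_int_int n). Qed.

Lemma Zp_int0 : Zp_int p 0. Proof. exact: (Zp_int_nat 0). Qed.

Lemma Zp_int1 : Zp_int p 1. Proof. exact: (Zp_int_nat 1). Qed.

Lemma Zp_intD x y : Zp_int p x -> Zp_int p y -> Zp_int p (x + y).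
Proof.
move=> /(Zp_intP p _ p_pr)[n [d pd ->]] /(Zp_intP p _ p_pr)[m [e pe ->]].
apply/Zp_intP => //; exists (n * e + m * d), (d * e)%N.
  by rewrite Euclid_dvdM // negb_or pd.
have d0 : d%:R != 0 :> rat.
  by rewrite pnatr_eq0; apply: contraNneq pd => ->; rewrite dvdn0.
have e0 : e%:R != 0 :> rat.
  by rewrite pnatr_eq0; apply: contraNneq pe => ->; rewrite dvdn0.
by rewrite intrD !intrM natrM -!pmulrn; field; rewrite e0 d0.
Qed.

Lemma Zp_intM x y : Zp_int p x -> Zp_int p y -> Zp_int p (x * y).
Proof.
move=> /(Zp_intP p _ p_pr)[n [d pd ->]] /(Zp_intP p _ p_pr)[m [e pe ->]].
apply/Zp_intP => //; exists (n * m), (d * e)%N.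
  by rewrite Euclid_dvdM // negb_or pd.
by rewrite intrM natrM mulf_div.
Qed.

Lemma Zp_intN x : Zp_int p x -> Zp_int p (- x).
Proof. by rewrite /Zp_int denqN. Qed.

Lemma Zp_intB x y : Zp_int p x -> Zp_int p y -> Zp_int p (x - y).
Proof. by move=> px py; apply: Zp_intD => //; apply: Zp_intN. Qed.

Lemma Zp_intX x n : Zp_int p x -> Zp_int p (x ^+ n).
Proof.
move=> px; elim: n => [|n IHn]; first exact: Zp_int1.
by rewrite exprS Zp_intM.
Qed.

Lemma Zp_int_sum n (F : nat -> rat) :
  (forall k, (k < n)%N -> Zp_int p (F k)) -> Zp_int p (\sum_(k < n) F k).
Proof.
by move=> pF; elim/big_ind: _ => [|x y|i _]; [exact: Zp_int0 | exact: Zp_intD | apply: pF].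
Qed.

Lemma Zp_int_prod n (F : nat -> rat) :
  (forall k, (k < n)%N -> Zp_int p (F k)) -> Zp_int p (\prod_(k < n) F k).
Proof.
by move=> pF; elim/big_ind: _ => [|x y|i _]; [exact: Zp_int1 | exact: Zp_intM | apply: pF].
Qed.

Lemma Zp_int_natV n : ~~ (p %| n)%N -> Zp_int p n%:R^-1.
Proof. by move=> pn; apply/Zp_intP => //; exists 1, n; rewrite ?div1r. Qed.

(** If [x / p] is not p-integral, [p] does not divide the numerator of [x], which may then serve as
    a denominator. *)
Lemma Zp_intV x : Zp_int p x -> ~~ Zp_int p (x / p%:R) -> Zp_int p x^-1.
Proof.
move=> /(Zp_intP p _ p_pr)[n [d pd ->]] px.
have p0 : p%:R != 0 :> rat by rewrite pnatr_eq0 -lt0n prime_gt0.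
have pn : ~~ (p %| `|n|)%N.
  apply: contra px => /dvdnP[m nE].
  rewrite [n]intEsign nE PoszM !intrM -[p%:~R]/(p%:R) mulrA mulrAC mulfK //.
  by apply: Zp_intM; [rewrite -intrM; apply: Zp_int_int | apply: Zp_int_natV].
rewrite invf_div [n]intEsign intrM invfM.
rewrite mulrCA; apply: Zp_intM; last first.
  by apply: Zp_intM; [apply: Zp_int_nat | apply: Zp_int_natV].
by case: (n < 0); rewrite ?expr1 ?expr0 ?mulrN1z ?invrN invr1; [apply/Zp_intN|]; apply: Zp_int1.
Qed.

(** For [x = n / d] and a Bezout relation [u * d + v * p = 1], take [r] to be the residue of
    [- n * u]; with [q] the quotient, [x + r = p * (n * v - q * d) / d]. *)
Lemma Zp_residue x : Zp_int p x ->
  exists2 r : nat, (r < p)%N & Zp_int p ((x + r%:R) / p%:R).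
Proof.
move=> /(Zp_intP p _ p_pr)[n [d pd ->]].
have p0 : p%:R != 0 :> rat by rewrite pnatr_eq0 -lt0n prime_gt0.
have pz0 : p%:Z != 0 by rewrite eqz_nat -lt0n prime_gt0.
have d0 : d%:R != 0 :> rat.
  by rewrite pnatr_eq0; apply: contraNneq pd => ->; rewrite dvdn0.
have /coprimezP[[u v] /= uvE] : coprimez d p.
  by rewrite coprimezE /= coprime_sym prime_coprime.
have rE : `|(- (n * u) %% p)%Z|%N%:Z = (- (n * u) %% p)%Z.
  by rewrite gez0_abs // modz_ge0.
exists `|(- (n * u) %% p)%Z|%N.
  by rewrite -ltz_nat rE; have := ltz_mod (- (n * u)) pz0.
have -> : `|(- (n * u) %% p)%Z|%N%:R = (- (n * u) %% p)%Z%:~R :> rat by rewrite -[in RHS]rE.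
set q := (- (n * u) %/ p)%Z.
have -> : (- (n * u) %% p)%Z = - (n * u) - q * p 
  by apply/eqP; rewrite eq_sym subr_eq addrC; apply/eqP/divz_eq.
have -> : (n%:~R / d%:R + (- (n * u) - q * p)%:~R) / p%:R =
          (n * v - q * d)%:~R / d%:R :> rat.
  have /(congr1 (fun z : int => z%:~R : rat)) : u * d = 1 - v * p.
    by rewrite -uvE addrK.
  rewrite !(intrD, intrM, mulrNz) -[p%:~R]/(p%:R) -[d%:~R]/(d%:R) => udE.
  transitivity ((n%:~R - n%:~R * (u%:~R * d%:R) - q%:~R * d%:R * p%:R) / (d%:R * p%:R)
                : rat); first by field; rewrite ?p0 ?d0.
  by rewrite udE; field; rewrite ?p0 ?d0.
by apply: Zp_intM; [exact: Zp_int_int | exact: Zp_int_natV].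
Qed.

(** The shifts of [x] by [0, ..., p - 1] meet every residue class, so one factor absorbs the
    division by [p]. *)
Lemma Zp_int_prod_residues x : Zp_int p x ->
  Zp_int p ((\prod_(i < p) (x + i%:R)) / p%:R).
Proof.
move=> px; have [r ltrp pr] := Zp_residue _ px.
rewrite (bigD1 (Ordinal ltrp)) //= mulrAC; apply: Zp_intM => //.
elim/big_ind: _ => [|y z|i _]; [exact: Zp_int1 | exact: Zp_intM |].
by apply: Zp_intD => //; apply: Zp_int_nat.
Qed.

(** Turns an exact identity with an explicit error term into a congruence. *)
Lemma Zp_congrI m x y z : Zp_int p y -> Zp_int p z ->
  x = y + p%:R ^+ m * z -> Zp_congr p m x y.
Proof.
move=> py pz ->; have p0 : p%:R != 0 :> rat by rewrite pnatr_eq0 -lt0n prime_gt0.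
apply/and3P; split=> //.
  by apply: Zp_intD => //; apply: Zp_intM => //; apply/Zp_intX/Zp_int_nat.
by rewrite addrC addKr mulrC mulKf // expf_neq0.
Qed.

End ZpInt.

(** * Recurrences in [k] for the summands and their common factor *)

Definition term (a : rat) (k : nat) : rat :=
  gbinom a k * gbinom (-1 - a) k * 'C(2 * k, k)%:R / 4%:R ^+ k.

(* The v_k above, in hypergeometric form: this makes sense also when a is an
   integer that kills a factor of the denominator in the other form. *)
Definition core (a : rat) (k : nat) : rat :=
  (\prod_(i < k) (2%:R^-1 + i%:R)) * (\prod_(i < k) (a - 1 + i%:R)) *
  (\prod_(i < k) (- 1 - a + i%:R)) / k`!%:R ^+ 3 / (a * (a + 1) * (a - 1)).

Lemma coreS a k : core a k.+1 =
  core a k * (- ((2 * k).+1%:R * (a - 1 + k%:R) * (a + 1 - k%:R)) /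
                  (2%:R * k.+1%:R ^+ 3)).
Proof.
(* Keeping the inverse [D] opaque spares [field] the conditions that [a], [a + 1] and [a - 1] be
   nonzero. *)
rewrite /core !big_ord_recr factS natrM /= !invfM; set D := a^-1 * _ * _; field.
by rewrite nat1r !pnatr_eq0 -!lt0n fact_gt0.
Qed.

Lemma gbinomS a k : gbinom a k.+1 = gbinom a k * (a - k%:R) / k.+1%:R.
Proof.
rewrite /gbinom big_ord_recr factS natrM /=; field.
by rewrite nat1r !pnatr_eq0 -!lt0n fact_gt0.
Qed.

(** Two absorption identities pass from ['C(2 * k, k)] through ['C((2 * k).+1, k)] to
    ['C(2 * k.+1, k.+1)]. *)
Lemma central_binS (k : nat) :
  'C(2 * k.+1, k.+1)%:R / 4%:R ^+ k.+1 =
  'C(2 * k, k)%:R / 4%:R ^+ k * ((2 * k).+1%:R / (2%:R * k.+1%:R)) :> rat.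
Proof.
have binE : (k.+1 * 'C(2 * k.+1, k.+1) = 2 * ((2 * k).+1 * 'C(2 * k, k)))%N.
  have /= e1 := mul_bin_diag (2 * k).+2 k.
  have /= e2 := mul_bin_down (2 * k).+1 k.
  have -> : (2 * k.+1 = (2 * k).+2)%N by lia.
  have e3 : ((2 * k).+1 - k = k.+1)%N by lia.
  by rewrite e2 e3 mulnA -e1; congr (_ * _)%N; lia.
have k0 : k.+1%:R != 0 :> rat by rewrite pnatr_eq0.
have binR : k.+1%:R * 'C(2 * k.+1, k.+1)%:R =
            2%:R * ((2 * k).+1%:R * 'C(2 * k, k)%:R) :> rat.
  by rewrite -!natrM binE.
apply: (mulfI k0); rewrite [LHS]mulrA binR exprS; field.
by rewrite nat1r k0 expf_neq0.
Qed.

Lemma termS a k : term a k.+1 = term a k *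
  ((2 * k).+1%:R * (k%:R - a) * (a + k.+1%:R) / (2%:R * k.+1%:R ^+ 3)).
Proof.
have k0 : k%:R + 1 != 0 :> rat by rewrite natr1 pnatr_eq0.
rewrite /term -mulrA central_binS !gbinomS -!natr1 natrM; field.
by rewrite k0 expf_neq0.
Qed.

Lemma prod_skip_last n (F : nat -> rat) :
  \prod_(i < n.+1 | i.+1%:R != n.+1%:R :> rat) F i = \prod_(i < n) F i.
Proof.
rewrite big_mkcond big_ord_recr /= eqxx mulr1; apply: eq_bigr => i _.
by rewrite eqr_nat eqSS ltn_eqF.
Qed.

Lemma gbinom_quot_last a k :
  gbinom_quot a k.+1 k.+1%:R = - gbinom (-1 - a) k / k.+1%:R.
Proof.
rewrite gbinom_quot_nat ?leqnn // /gbinom factS natrM.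
rewrite (eq_bigl (fun i : 'I_k.+1 => i.+1%:R != k.+1%:R :> rat)); last first.
  by move=> i; rewrite eqr_nat.
rewrite (prod_skip_last _ (fun i => -1 - a - i%:R)); field.
by rewrite nat1r !pnatr_eq0 -!lt0n fact_gt0.
Qed.

(** Removing the factor of index [k] leaves the last one, [- (a + k.+2)], whose sign cancels the
    sign in front of the product. *)
Lemma gbinom_quot_penult a k :
  gbinom_quot a k.+2 (k.+2%:R - 1) =
  gbinom (-1 - a) k * (a + k.+2%:R) / (k.+1%:R * k.+2%:R).
Proof.
have -> : k.+2%:R - 1 = k.+1%:R :> rat by rewrite -[k.+2%:R]natr1 addrK.
rewrite gbinom_quot_nat ?leqnSn // /gbinom !factS !natrM.
rewrite big_mkcond big_ord_recr /= -big_mkcond /= ifT; last by lia.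
rewrite (eq_bigl (fun i : 'I_k.+1 => i.+1%:R != k.+1%:R :> rat)); last first.
  by move=> i; rewrite eqr_nat.
rewrite (prod_skip_last _ (fun i => -1 - a - i%:R)); field.
by rewrite nat1r -natrD !pnatr_eq0 -[_`!]prednK ?fact_gt0.
Qed.

(** * Summands as multiples of [core], and the telescoping identities *)

Section Core.

Variable a : rat.
Hypotheses (a0 : a != 0) (a1 : a - 1 != 0) (aN1 : a + 1 != 0).

(** Both sides equal 1 at [k = 0] and satisfy compatible recurrences. The induction never divides by
    [a + k] or [a + k - 1], which may vanish. *)
Lemma term_core k :
  term a k = core a k * ((a + 1 - k%:R) * (a + k%:R) * (a + k%:R - 1)).
Proof.
elim: k => [|k IHk].
  rewrite /term /core /gbinom !big_ord0 expr0 muln0 bin0 fact0; field.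
  by rewrite a0 a1 aN1.
rewrite termS coreS IHk; field.
by rewrite nat1r pnatr_eq0.
Qed.

Lemma term_succ_core k :
  term (a + 1) k = core a k * ((a + 1 + k%:R) * (a + k%:R) * (a + k%:R - 1)).
Proof.
elim: k => [|k IHk].
  rewrite /term /core /gbinom !big_ord0 expr0 muln0 bin0 fact0; field.
  by rewrite a0 a1 aN1.
rewrite termS coreS IHk; field.
by rewrite nat1r pnatr_eq0.
Qed.

Lemma quot_core k :
  gbinom a k * gbinom_quot a k k%:R * 'C(2 * k, k)%:R / 4%:R ^+ k =
  core a k * ((a + 1 - k%:R) * (a + k%:R - 1)).
Proof.
case: k => [|k].
  rewrite gbinom_quotE ?addr0 // /core /gbinom !big_ord0 expr0 muln0 bin0 fact0; field.
  by rewrite a0 a1 aN1.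
rewrite -mulrA central_binS gbinom_quot_last gbinomS.
(* The factor [a + k.+1] is already cancelled, so [term a k] gives the value without dividing by
   it. *)
transitivity (- (term a k * (a - k%:R) * (2 * k).+1%:R / (2%:R * k.+1%:R ^+ 3))).
  rewrite /term; field.
  by rewrite nat1r pnatr_eq0 expf_neq0.
rewrite coreS term_core; field.
by rewrite nat1r pnatr_eq0.
Qed.

Lemma quot_pred_core k :
  gbinom a k * gbinom_quot a k (k%:R - 1) * 'C(2 * k, k)%:R / 4%:R ^+ k =
  core a k * ((a + 1 - k%:R) * (a + k%:R)).
Proof.
(* For [k = 0, 1] the shift [k - 1] is -1 or 0 and the quotient is literal, as [a - 1] and [a] are
   nonzero; cancellation inside the product starts at [k = 2]. *)
case: k => [|[|k]].
- rewrite gbinom_quotE ?sub0r // /core /gbinom !big_ord0 expr0 muln0 bin0 fact0; field.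
  by rewrite a0 a1 aN1.
- rewrite subrr gbinom_quotE ?addr0 // /core /gbinom !big_ord1 bin1 muln1 !expr1 !factS fact0 /=; field.
  by rewrite a0 a1 aN1.
rewrite -mulrA central_binS gbinom_quot_penult !gbinomS.
transitivity (term a k * ((a - k%:R) * (a - k.+1%:R) * (a + k.+2%:R) *
  (2 * k).+1%:R * (2 * k.+1).+1%:R / (4%:R * k.+1%:R ^+ 3 * k.+2%:R ^+ 3))).
  rewrite central_binS /term; field.
  by rewrite nat1r -natrD !pnatr_eq0 expf_neq0.
rewrite !coreS term_core; field.
by rewrite nat1r -natrD !pnatr_eq0.
Qed.

Lemma SsumS b n : Ssum n.+1 b = Ssum n b + term b n.
Proof. by rewrite /Ssum big_ord_recr. Qed.

(** The last summand is the Gosper certificate. By [coreS], [n.+1 ^ 3 * core a n.+1] is a polynomial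
    multiple of [core a n], so the induction step is a rational identity in [a] and [n]. *)
Lemma sum_quot n :
  \sum_(k < n) gbinom a k * gbinom_quot a k k%:R * 'C(2 * k, k)%:R / 4%:R ^+ k =
  1 / (2%:R * a) * Ssum n a + (a + 1) ^+ 2 / (2%:R * a ^+ 3) * Ssum n (a + 1) +
  n%:R ^+ 3 * (core a n * ((a + n%:R - 1) * (2%:R * a + 1) / a ^+ 3)).
Proof.
elim: n => [|n IHn]; first by rewrite /Ssum !big_ord0 expr0n !mulr0 mul0r !addr0.
rewrite big_ord_recr /= IHn quot_core !SsumS term_core term_succ_core coreS; field.
by rewrite a0 nat1r pnatr_eq0.
Qed.

Lemma sum_quot_pred n :
  \sum_(k < n) gbinom a k * gbinom_quot a k (k%:R - 1) *
    'C(2 * k, k)%:R / 4%:R ^+ k =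
  ((a - 1) ^+ 2 + 1) / (2%:R * (a - 1) ^+ 3) * Ssum n a +
  (a + 1) ^+ 2 / (2%:R * a ^+ 2 * (a - 1)) * Ssum n (a + 1) +
  n%:R ^+ 3 * (core a n *
    ((a * (2%:R * a ^+ 3 - 2%:R * a ^+ 2 + 1) +
      (2%:R * a ^+ 3 - 4%:R * a ^+ 2 + 1) * (n%:R - 1)) /
     (a ^+ 2 * (a - 1) ^+ 3))).
Proof.
elim: n => [|n IHn]; first by rewrite /Ssum !big_ord0 expr0n !mulr0 mul0r !addr0.
rewrite big_ord_recr /= IHn quot_pred_core !SsumS term_core term_succ_core coreS; field.
by rewrite a0 a1 nat1r pnatr_eq0.
Qed.

(** The left sum stops one index before the two [Ssum], so [n = p.-1] gives the sum up to [p - 2]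
    together with [Ssum p] and an error in [p ^ 3]. *)
Lemma sum_term_div n :
  \sum_(k < n) gbinom a k * gbinom (-1 - a) k * 'C(2 * k, k)%:R /
    (4%:R ^+ k * (k%:R + 1)) =
  Ssum n.+1 a + (a + 1) / a * Ssum n.+1 (a + 1) +
  n.+1%:R ^+ 3 * (core a n.+1 *
    (2%:R * (a + n%:R) * (2%:R * a + 2%:R * n%:R + 1) / (a * (2 * n).+1%:R))).
Proof.
elim: n => [|n IHn].
  (* The left sum is empty, but each [Ssum 1] is 1: the boundary term must equal
     [- (2 * a + 1) / a]. *)
  rewrite !SsumS /Ssum !big_ord0 term_core term_succ_core coreS /core.
  rewrite !big_ord0 fact0 muln0; field.
  by rewrite a0 a1 aN1.
rewrite big_ord_recr /= IHn.
have -> : gbinom a n * gbinom (-1 - a) n * 'C(2 * n, n)%:R /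
    (4%:R ^+ n * (n%:R + 1)) = term a n / n.+1%:R.
  by rewrite invfM mulrA natr1.
rewrite [Ssum n.+2 _]SsumS.
rewrite [Ssum n.+2 (a + 1)]SsumS !term_core !term_succ_core !coreS; field.
by rewrite a0 !nat1r -!natrM !nat1r -natrD !pnatr_eq0.
Qed.

End Core.

(** * Integrality of [core a k] for [k] up to [p] *)

Ltac zp_int := repeat match goal with
  | H : is_true (Zp_int ?p ?x) |- is_true (Zp_int ?p ?x) => exact H
  | H : is_true ?b |- is_true ?b => exact H
  | |- is_true (Zp_int _ (_ + _)) => apply: Zp_intD
  | |- is_true (Zp_int _ (- _)) => apply: Zp_intN
  | |- is_true (Zp_int _ (_ * _)) => apply: Zp_intM
  | |- is_true (Zp_int _ (_ ^+ _)) => apply: Zp_intX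
  | |- is_true (Zp_int _ _%:R) => apply: Zp_int_nat
  | |- is_true (Zp_int _ 1) => apply: Zp_int1
  end.

Section Integrality.

Variables (p : nat) (a : rat).
Hypotheses (p_pr : prime p) (pa : Zp_int p a).
Hypotheses (pVa : Zp_int p a^-1) (pVa1 : Zp_int p (a - 1)^-1).
Hypotheses (pVaN1 : Zp_int p (a + 1)^-1) (pV2 : Zp_int p 2%:R^-1).

Lemma Zp_int_factV n : (n < p)%N -> Zp_int p n`!%:R^-1.
Proof.
elim: n => [|n IHn] ltnp; first by rewrite fact0 invr1; zp_int.
rewrite factS natrM invfM; apply: Zp_intM => //; last by apply: IHn; apply: ltnW.
by apply: Zp_int_natV => //; rewrite gtnNdvd.
Qed.

Lemma core_int n : (n < p)%N -> Zp_int p (core a n).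
Proof.
move=> ltnp; have pf := Zp_int_factV _ ltnp.
(* [zp_int] has no rule for inverses: they are split into inverses whose integrality is a
   hypothesis. *)
rewrite /core -exprVn !invfM.
have prod_int b : Zp_int p b -> Zp_int p (\prod_(i < n) (b + i%:R)).
  by move=> pb; apply: (Zp_int_prod _ p_pr _ (fun i => b + i%:R)) => k _; zp_int.
by zp_int; apply: prod_int; zp_int.
Qed.

Lemma core_prime_int : Zp_int p (core a p).
Proof.
have p_gt0 := prime_gt0 p_pr.
have pf : Zp_int p (p.-1)`!%:R^-1 by apply: Zp_int_factV; rewrite prednK.
have res b : Zp_int p b -> Zp_int p ((\prod_(i < p) (b + i%:R)) / p%:R).
  exact: Zp_int_prod_residues.
(* From [p! ^ 3 = p ^ 3 * (p - 1)! ^ 3], one factor [p] goes under each of the three products. *)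
have -> : core a p = (\prod_(i < p) (2%:R^-1 + i%:R)) / p%:R *
    ((\prod_(i < p) (a - 1 + i%:R)) / p%:R) *
    ((\prod_(i < p) (- 1 - a + i%:R)) / p%:R) *
    ((p.-1)`!%:R^-1 ^+ 3 * (a * (a + 1) * (a - 1))^-1).
  rewrite /core -[X in X`!]prednK // factS prednK // natrM.
  set D := (a * _ * _)^-1; field.
  by rewrite !pnatr_eq0 -!lt0n fact_gt0.
rewrite !invfM.
have p2 := res _ pV2.
have pm : Zp_int p ((\prod_(i < p) (a - 1 + i%:R)) / p%:R) by apply: res; zp_int.
have pn : Zp_int p ((\prod_(i < p) (- 1 - a + i%:R)) / p%:R) by apply: res; zp_int.
by zp_int.
Qed.

End Integrality.

(** * The four congruences *)

Theorem theorem12p1 (p : nat) (a : rat) :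
  prime p -> odd p -> Zp_int p a ->
  ~~ Zp_congr p 1 a 0 -> ~~ Zp_congr p 1 a 1 -> ~~ Zp_congr p 1 a (-1) ->
  [/\ Zp_congr p 3
        (\sum_(k < p) gbinom a k * gbinom_quot a k k%:R
                        * 'C(2 * k, k)%:R / 4%:R ^+ k)
        (1 / (2%:R * a) * Ssum p a
         + (a + 1) ^+ 2 / (2%:R * a ^+ 3) * Ssum p (a + 1)),
      Zp_congr p 3
        (1 / (2%:R * a) * Ssum p a
         + (a + 1) ^+ 2 / (2%:R * a ^+ 3) * Ssum p (a + 1))
        ((a + 1) / (2%:R * a ^+ 2)
           * (\sum_(k < p.-1) gbinom a k * gbinom (-1 - a) k
                                * 'C(2 * k, k)%:R / (4%:R ^+ k * (k%:R + 1)))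
         - 1 / (2%:R * a ^+ 2) * Ssum p a),
      Zp_congr p 3
        (\sum_(k < p) gbinom a k * gbinom_quot a k (k%:R - 1)
                        * 'C(2 * k, k)%:R / 4%:R ^+ k)
        (((a - 1) ^+ 2 + 1) / (2%:R * (a - 1) ^+ 3) * Ssum p a
         + (a + 1) ^+ 2 / (2%:R * a ^+ 2 * (a - 1)) * Ssum p (a + 1))
    & Zp_congr p 3
        (((a - 1) ^+ 2 + 1) / (2%:R * (a - 1) ^+ 3) * Ssum p a
         + (a + 1) ^+ 2 / (2%:R * a ^+ 2 * (a - 1)) * Ssum p (a + 1))
        ((a + 1) / (2%:R * a * (a - 1))
           * (\sum_(k < p.-1) gbinom a k * gbinom (-1 - a) k
                                * 'C(2 * k, k)%:R / (4%:R ^+ k * (k%:R + 1)))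
         - (a ^+ 2 - 3%:R * a + 1) / (2%:R * a * (a - 1) ^+ 3) * Ssum p a)].
Proof.
move=> p_pr p_odd pa na0 na1 naN1.
have p_gt0 := prime_gt0 p_pr; have p_gt1 := prime_gt1 p_pr.
have pV2 : Zp_int p 2%:R^-1.
  apply: Zp_int_natV => //; apply/negP=> p_dvd2.
  have p_le2 := dvdn_leq (isT : (0 < 2)%N) p_dvd2.
  have pE : p = 2%N by lia.
  by rewrite pE in p_odd.
(* This is [2 * p - 1], the denominator in the boundary term of [sum_term_div] at [n = p.-1]. *)
have pVp : Zp_int p (2 * p.-1).+1%:R^-1.
  apply: Zp_int_natV => //.
  have -> : ((2 * p.-1).+1 = p + p.-1)%N by lia.
  by rewrite dvdn_addr // gtnNdvd ?prednK //; lia.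
(* With [b = 0, 1, -1], the three incongruences make [a], [a - 1] and [a + 1] units. *)
have unit b : Zp_int p b -> ~~ Zp_congr p 1 a b -> Zp_int p (a - b)^-1.
  rewrite /Zp_congr pa expr1 => pb; rewrite pb /= => ndv.
  by apply: Zp_intV => //; apply: Zp_intB.
have pVa : Zp_int p a^-1 by rewrite -[a]subr0; apply: unit => //; apply: Zp_int0.
have pVa1 : Zp_int p (a - 1)^-1 by apply: unit => //; apply: Zp_int1.
have pVaN1 : Zp_int p (a + 1)^-1.
  by rewrite -[1]opprK; apply: unit => //; apply: Zp_intN; apply: Zp_int1.
have a0 : a != 0 by apply: contraNneq na0 => ->; rewrite /Zp_congr subrr mul0r Zp_int0.
have a1 : a - 1 != 0.
  rewrite subr_eq0; apply: contraNneq na1 => ->.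
  by rewrite /Zp_congr subrr mul0r Zp_int0 // Zp_int1.
have aN1 : a + 1 != 0.
  rewrite addr_eq0; apply: contraNneq naN1 => ->.
  by rewrite /Zp_congr subrr mul0r Zp_int0 // Zp_intN // Zp_int1.
have pv := core_prime_int p a p_pr pa pVa pVa1 pVaN1 pV2.
have pvk k : (k < p)%N -> Zp_int p (core a k) by apply: core_int.
have pS : Zp_int p (Ssum p a).
  apply: (Zp_int_sum _ p_pr _ (term a)) => k ltkp.
  by rewrite term_core //; have := pvk _ ltkp => ?; zp_int.
have pS1 : Zp_int p (Ssum p (a + 1)).
  apply: (Zp_int_sum _ p_pr _ (term (a + 1))) => k ltkp.
  by rewrite term_succ_core //; have := pvk _ ltkp => ?; zp_int.
(* The relation [Q = S_p(a) + (a + 1) / a * S_p(a + 1) + p ^ 3 * E] serves to eliminate [S_p(a + 1)]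
   from the right-hand sides. *)
have := sum_term_div a a0 a1 aN1 p.-1; rewrite prednK //.
set Q := \sum_(k < p.-1) _; set E := core a p * _ => QE.
have pE : Zp_int p E by rewrite /E !invfM; zp_int.
have pQ : Zp_int p Q by rewrite QE; zp_int.
clearbody E; clearbody Q.
split.
- rewrite sum_quot //; apply: (Zp_congrI _ p_pr); last reflexivity.
    by rewrite !invfM -?exprVn; zp_int.
  by rewrite !invfM -?exprVn; zp_int.
(* The coefficient of [S_p(a + 1)] is [(a + 1) / (2 * a ^ 2)] times [(a + 1) / a], so eliminating it
   multiplies [- E] by the former. *)
- apply: (Zp_congrI _ p_pr _ _ _ (- ((a + 1) * E) / (2%:R * a ^+ 2))).
  + by rewrite !invfM -?exprVn; zp_int.
  + by rewrite !invfM -?exprVn; zp_int.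
  + by rewrite QE; field; rewrite a0.
- rewrite sum_quot_pred //; apply: (Zp_congrI _ p_pr); last reflexivity.
  + by rewrite !invfM -?exprVn; zp_int.
  + by rewrite !invfM -?exprVn; zp_int.
(* Same elimination, with multiplier [(a + 1) / (2 * a * (a - 1))]. *)
- apply: (Zp_congrI _ p_pr _ _ _ (- ((a + 1) * E) / (2%:R * a * (a - 1)))).
  + by rewrite !invfM -?exprVn; zp_int.
  + by rewrite !invfM -?exprVn; zp_int.
  + by rewrite QE; field; rewrite a0 a1.
Qed.
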